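(* For all integers $n,m\ge0$ and every $x$: (1) $\widehat{\mathcal{C}}_{n,m}^{(k)}(a,q,L;x)=\dfrac{(a+m)^k}{a^k}\sum_{i=0}^{n}q^{n-i}\mathcal{T}_n^i\!\Big(\dfrac{x}{q}\Big)\dfrac{(-1)^il^{a+i}}{(a+i+m)^k}$; (2) $\widehat{\mathcal{C}}_{n,m}^{(k)}(a,q,L;x)=\sum_{j=0}^{n}(-1)^{n-j}\binom{n}{j}\widehat{\mathcal{C}}_{j,m}^{(k)}(a,q,L)\,(x)_{q,n-j}$.
   Context: Let $k\ge1$ be an integer, $a,q,l_1,\dots,l_k$ nonzero reals, $l=\prod l_i$, $L=(l_1,\dots,l_k)$; denominators $a+j$ ($j\ge0$ integer) assumed nonzero and $l^{a+i}$ means $l^al^i$. Let $s(n,i)$ be the signed Stirling numbers of the first kind ($\frac{1}{i!}(\ln(1+x))^i=\sum_{n\ge i}s(n,i)\frac{x^n}{n!}$), $\widehat{\mathcal{C}}_{n,m}^{(k)}(a,q,L)=\frac{(a+m)^k}{a^k}\sum_{i=0}^{n}s(n,i)\frac{(-1)^iq^{n-i}l^{a+i}}{(a+i+m)^k}$, $\operatorname{Lif}_k(w;b)=\sum_{n\ge0}\frac{1}{(n+b)^k}\frac{w^n}{n!}$, and $(x)_{q,n}=x(x+q)\cdots(x+(n-1)q)$, $(x)_{q,0}=1$. The generalized $m$-poly-Cauchy polynomials of the second kind are defined by \[ \frac{l^a(a+m)^k}{a^k(1+qz)^{x/q}}\operatorname{Lif}_k\!\Big(-\frac{l\ln(1+qz)}{q};a+m\Big)=\sum_{n\ge0}\widehat{\mathcal{C}}_{n,m}^{(k)}(a,q,L;x)\frac{z^n}{n!}.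 \] The weighted Stirling numbers of the first kind are defined by $\frac{1}{i!}\frac{(\ln(1+z))^i}{(1+z)^x}=\sum_{n\ge i}\mathcal{T}_n^i(x)\frac{z^n}{n!}$. *)

(* Defs.v *)
From mathcomp Require Import all_boot all_order all_algebra.
From mathcomp Require Import complex.
From mathcomp Require Import all_classical all_reals all_analysis.

Set Implicit Arguments.
Unset Strict Implicit.
Unset Printing Implicit Defensive.

Import Order.TTheory GRing.Theory Num.Theory.
Local Open Scope ring_scope.
Local Open Scope complex_scope.

(* Generating functions are read as formal power series in z; a series
   \sum_n f_n z^n is represented by its coefficient sequence n |-> f_n. *)
Section FormalPowerSeries.
Variable K : fieldType.
Implicit Types (f g : nat -> K) (c e : K) (n i : nat).

Definition fps1 : nat -> K := fun n => (n == 0)%:R.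

Definition fps_scale c f : nat -> K := fun n => c * f n.

Definition fps_mul f g : nat -> K :=
  fun n => \sum_(i < n.+1) f i * g (n - i)%N.

Definition fps_pow f i : nat -> K := iter i (fps_mul f) fps1.

(* The composite f(g(z)) = \sum_i f_i g(z)^i. It is meaningful only when
   g_0 = 0: then g^i has order at least i, so that only the terms with
   i <= n contribute to the coefficient of z^n. *)
Definition fps_comp f g : nat -> K :=
  fun n => \sum_(i < n.+1) f i * fps_pow g i n.

Definition fps_exp : nat -> K := fun n => (n`!%:R)^-1.

(* ln (1 + c z) = \sum_(n >= 1) (-1)^(n-1) c^n z^n / n *)
Definition fps_ln1p c : nat -> K :=
  fun n => if n is n'.+1 then (-1) ^+ n' * c ^+ n / n%:R else 0.

(* (1 + c z)^e = exp (e ln (1 + c z)) *)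
Definition fps_pow1p c e : nat -> K :=
  fps_comp fps_exp (fps_scale e (fps_ln1p c)).

(* The u_n such that f(z) = \sum_n u_n z^n / n! *)
Definition egf_coef f n : K := n`!%:R * f n.

Definition stirling1 n i : K :=
  egf_coef (fps_scale (i`!%:R)^-1 (fps_pow (fps_ln1p 1) i)) n.

Definition weighted_stirling1 n i (x : K) : K :=
  egf_coef (fps_scale (i`!%:R)^-1
    (fps_mul (fps_pow (fps_ln1p 1) i) (fps_pow1p 1 (- x)))) n.

(* Lif_k(w; b), as a series in w *)
Definition Lif (k : nat) (b : K) : nat -> K :=
  fun n => ((n%:R + b) ^+ k)^-1 * (n`!%:R)^-1.

(* (x)_{q,n} = x (x + q) ... (x + (n-1) q) *)
Definition qrising (q x : K) n : K := \prod_(i < n) (x + i%:R * q).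

End FormalPowerSeries.

Section PolyCauchy.
Variable R : realType.

(* The principal value of l^a for real l and a; l may be negative, and then
   l^a = |l|^a exp (i pi a). *)
Definition real_cpow (l a : R) : R[i] :=
  if 0 <= l then (l `^ a)%:C
  else (`|l| `^ a)%:C * (cos (pi * a) +i* sin (pi * a)).

Definition lprod (k : nat) (L : 'I_k -> R) : R := \prod_(i < k) L i.

(* l^(a+i), which stands for l^a l^i *)
Definition lpow (k : nat) (L : 'I_k -> R) (a : R) (i : nat) : R[i] :=
  real_cpow (lprod L) a * (lprod L)%:C ^+ i.

Definition poly_cauchy2 (k : nat) (a q : R) (L : 'I_k -> R) (n m : nat)
    : R[i] :=
  (a%:C + m%:R) ^+ k / a%:C ^+ k *
  \sum_(i < n.+1) stirling1 _ n i *
    ((-1) ^+ i * q%:C ^+ (n - i) * lpow L a i / (a%:C + i%:R + m%:R) ^+ k).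

Definition poly_cauchy2_gf (k : nat) (a q : R) (L : 'I_k -> R) (m : nat)
    (x : R[i]) : nat -> R[i] :=
  fps_scale (real_cpow (lprod L) a * (a%:C + m%:R) ^+ k / a%:C ^+ k)
    (fps_mul (fps_pow1p q%:C (- (x / q%:C)))
       (fps_comp (Lif k (a%:C + m%:R))
          (fps_scale (- ((lprod L)%:C / q%:C)) (fps_ln1p q%:C)))).

Definition poly_cauchy2_poly (k : nat) (a q : R) (L : 'I_k -> R) (n m : nat)
    (x : R[i]) : R[i] :=
  egf_coef (poly_cauchy2_gf a q L m x) n.

End PolyCauchy.

(* Main.v *)
Require Import Defs.
From mathcomp Require Import all_boot all_order all_algebra.
From mathcomp Require Import complex ring.
From mathcomp Require Import all_classical all_reals all_analysis.

Import Order.TTheory GRing.Theory Num.Theory.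
Local Open Scope ring_scope.
Local Open Scope complex_scope.

(** Write [P i] for the [i]-th power of [ln (1 + z)]. Since
    [ln (1 + c z)] arises from [ln (1 + z)] by the substitution [z := c z], every
    series involved has coefficients that are explicit combinations of those
    of the [P i], and (1) is the expansion of the product in the generating
    function, the sums being extended to a common range because [P i] has
    order at least [i]. For (2), differentiating gives
    [(1 + z) (P (i + 1))' = (i + 1) P i], so that [f = (1 + z)^e] satisfies
    [(1 + z) f' = e f]; hence [(1 + q z)^(- x / q)] has the coefficients
    [(-1)^n (x)_{q,n} / n!], and (2) is the Cauchy product of this series with
    the generating function at [x = 0]. *)

(** * Powers, dilations and truncations of formal power series *)

Section FpsField.
Context {K : fieldType}.
Implicit Types (f g : nat -> K) (c e : K).

Lemma fps_mulC f g n : fps_mul f g n = fps_mul g f n.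
Proof.
rewrite /fps_mul (reindex_inj rev_ord_inj) /=.
apply: eq_bigr => i _; rewrite subSS subKn 1?mulrC //.
by rewrite -ltnS.
Qed.

Lemma fps_powS f i n : fps_pow f i.+1 n = fps_mul f (fps_pow f i) n.
Proof. by []. Qed.

Lemma fps_pow_scale e f i n :
  fps_pow (fps_scale e f) i n = e ^+ i * fps_pow f i n.
Proof.
elim: i n => [|i IHi] n; first by rewrite expr0 mul1r.
rewrite !fps_powS /fps_mul big_distrr /=; apply: eq_bigr => j _.
by rewrite IHi /fps_scale exprS; ring.
Qed.

Lemma fps_pow_dilate c f i n :
  fps_pow (fun j => c ^+ j * f j) i n = c ^+ n * fps_pow f i n.
Proof.
elim: i n => [|i IHi] n.
  by rewrite /fps_pow /= /fps1; case: n => [|n]; rewrite ?expr0 ?mul1r ?mulr0.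
rewrite !fps_powS /fps_mul big_distrr /=; apply: eq_bigr => j _.
rewrite IHi -[in c ^+ n](subnKC (_ : j <= n)%N) ?exprD; first ring.
by rewrite -ltnS.
Qed.

Lemma fps_pow_order f i n : f 0%N = 0 -> (n < i)%N -> fps_pow f i n = 0.
Proof.
move=> f0; elim: i n => [|i IHi] n // lt_ni.
rewrite fps_powS /fps_mul big1 // => -[[|j] /= lt_j] _; first by rewrite f0 mul0r.
rewrite IHi ?mulr0 //.
by apply: (@leq_trans n) => //; rewrite ltn_subrL (leq_trans _ (lt_j : j < n)%N).
Qed.

Lemma fps_ln1p_dilate c : fps_ln1p c = fun n => c ^+ n * fps_ln1p 1 n.
Proof.
apply: funext => -[|n]; rewrite /fps_ln1p ?mulr0 // expr1n mulr1.
by rewrite mulrA [_ * c ^+ _]mulrC.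
Qed.

(** Dilating [z] by [c] contributes [c ^+ n], and scaling the inner series by [e] contributes
    [e ^+ i], so only powers of [ln (1 + z)] remain. *)
Lemma fps_comp_ln1p f c e n :
  fps_comp f (fps_scale e (fps_ln1p c)) n =
  c ^+ n * \sum_(i < n.+1) f i * e ^+ i * fps_pow (fps_ln1p 1) i n.
Proof.
rewrite /fps_comp big_distrr /=; apply: eq_bigr => i _.
by rewrite fps_pow_scale fps_ln1p_dilate fps_pow_dilate; ring.
Qed.

Lemma fps_pow1p_dilate c e n :
  fps_pow1p c e n = c ^+ n * fps_pow1p 1 e n.
Proof. by rewrite /fps_pow1p !fps_comp_ln1p expr1n mul1r. Qed.

(** Coefficients below degree [N] of a power see only the truncation of [f]; this gives access to
    polynomial algebra and derivatives. *)
Lemma fps_powE f N i n :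
  (n < N)%N -> fps_pow f i n = ((\poly_(j < N) f j) ^+ i)`_n.
Proof.
elim: i n => [|i IHi] n lt_nN; first by rewrite expr0 coef1.
rewrite fps_powS exprS coefM; apply: eq_bigr => j _.
have lt_jN : (j < N)%N by apply: leq_trans lt_nN; rewrite ltn_ord.
by rewrite coef_poly lt_jN IHi // (leq_ltn_trans (leq_subr _ _)).
Qed.

End FpsField.

(** * Differential recurrences for powers of the logarithm and the binomial series *)

Section FpsNumField.
Context {K : numFieldType}.
Implicit Types (q e x : K).

(** Truncated form of [(1 + z) (ln (1 + z))' = 1]: the derivative is a finite geometric sum in
    [- 'X], which telescopes up to one error term. *)
Lemma deriv_ln1p_trunc N :
  (1 + 'X) * (\poly_(j < N.+1) fps_ln1p (1 : K) j)^`() = 1 - (- 'X) ^+ N.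
Proof.
have -> : (\poly_(j < N.+1) fps_ln1p (1 : K) j)^`() = \sum_(j < N) (- 'X) ^+ j.
  apply/polyP => n; rewrite coef_deriv coef_poly coef_sum ltnS.
  have coefNX (j : nat) : ((- 'X : {poly K}) ^+ j)`_n = (-1) ^+ j * (n == j)%:R.
    by rewrite -scaleN1r exprZn coefZ coefXn.
  under eq_bigr do rewrite coefNX.
  case: ltnP => [lt_nN | le_Nn]; last first.
    rewrite mul0rn big1 // => j _.
    by rewrite gtn_eqF ?mulr0 // (leq_trans (ltn_ord j)).
  rewrite (bigD1 (Ordinal lt_nN)) //= eqxx mulr1 big1 => [|j ne_jn].
    by rewrite addr0 /fps_ln1p expr1n mulr1 -[LHS]mulr_natr divfK ?pnatr_eq0 //.
  by rewrite eq_sym [_ == n](_ : _ = false) ?mulr0 //; apply/negbTE.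
have -> : 1 + 'X = - (- 'X - 1) :> {poly K} by rewrite opprB opprK.
by rewrite mulNr -subrX1 opprB.
Qed.

Lemma fps_pow_ln1p_rec i n :
  n.+1%:R * fps_pow (fps_ln1p (1 : K)) i.+1 n.+1 +
    n%:R * fps_pow (fps_ln1p 1) i.+1 n =
  i.+1%:R * fps_pow (fps_ln1p 1) i n.
Proof.
(* Truncating below degree [n.+2] keeps the coefficient [n.+1], and the resulting error
   [(- 'X) ^+ n.+1] does not reach degree [n]. *)
rewrite !(@fps_powE _ _ n.+2) ?ltnS ?leqnSn //.
set p := \poly_(j < _) _.
have coefD : ((1 + 'X) * (p ^+ i.+1)^`())`_n
  = n.+1%:R * (p ^+ i.+1)`_n.+1 + n%:R * (p ^+ i.+1)`_n.
  rewrite mulrDl mul1r coefD coefXM !coef_deriv !mulr_natl.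
  by case: n @p => [|n] p.
rewrite -{}coefD deriv_exp /= mulrnAr mulrA deriv_ln1p_trunc coefMn mulr_natl.
rewrite mulrBl mul1r coefB -scaleN1r exprZn -scalerAl coefZ.
by rewrite coefXnM ltnSn mulr0 subr0.
Qed.

(** Coefficient form of [(1 + z) f' = e f]: sum the recurrence for the powers of the logarithm with
    weights [e ^+ i / i!]. *)
Lemma fps_pow1p_rec e n :
  n.+1%:R * fps_pow1p 1 e n.+1 = (e - n%:R) * fps_pow1p 1 e n.
Proof.
rewrite mulrBl; apply/eqP; rewrite eq_sym subr_eq; apply/eqP.
rewrite /fps_pow1p !fps_comp_ln1p !expr1n !mul1r.
set P := fps_pow _.
have P0 i : (n < i)%N -> P i n = 0 by apply: fps_pow_order.
have P0n j : P 0%N j = (j == 0)%:R by [].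
have Prec := fps_pow_ln1p_rec ^~ n; rewrite -/P in Prec; clearbody P.
have -> : \sum_(i < n.+1) fps_exp K i * e ^+ i * P i n =
          \sum_(i < n.+2) fps_exp K i * e ^+ i * P i n.
  by rewrite [RHS]big_ord_recr /= P0 // mulr0 addr0.
rewrite [in RHS]big_distrr [X in _ + X]big_distrr -big_split /=.
rewrite [RHS]big_ord_recl [in LHS]big_ord_recr /= P0 // mulr0 addr0.
(* The term [i = 0] vanishes: [P 0] is the series 1, and its constant coefficient comes with the
   factor [n = 0]. *)
rewrite [X in _ = X + _](_ : _ = 0) ?add0r; last first.
  by rewrite !P0n; case: n {P0 Prec} => [|n] /=; ring.
rewrite big_distrr /=; apply: eq_bigr => i _.
rewrite /bump /= add1n.
(* The extra factor [e] shifts the exponential weight from [i] to [i.+1], leaving the [i.+1] that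
   the recurrence requires. *)
transitivity (fps_exp K i.+1 * e ^+ i.+1 * (i.+1%:R * P i n)).
  rewrite /fps_exp factS natrM exprS invfM.
  have : i.+1%:R != 0 :> K by rewrite pnatr_eq0.
  have : i`!%:R != 0 :> K by rewrite pnatr_eq0 -lt0n fact_gt0.
  move=> ? ?; field; exact/andP.
by rewrite -Prec; ring.
Qed.

(** By induction: each step multiplies by [q (- x / q - n) = - (x + n q)], the next factor of the
    rising product up to sign. *)
Lemma fps_pow1p_qrising q x n : q != 0 ->
  n`!%:R * fps_pow1p q (- (x / q)) n = (-1) ^+ n * qrising q x n.
Proof.
move=> q0; rewrite fps_pow1p_dilate; elim: n => [|n IHn].
  rewrite /fps_pow1p /fps_comp /qrising big_ord0 big_ord_recl big_ord0.
  by rewrite /fps_exp /fps_pow /= /fps1 /= fact0 invr1; ring.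
have := fps_pow1p_rec (- (x / q)) n.
rewrite factS natrM /qrising big_ord_recr /= -/(qrising q x n) => rec.
transitivity (n`!%:R * q ^+ n.+1 * (n.+1%:R * fps_pow1p 1 (- (x / q)) n.+1)).
  by ring.
rewrite {}rec.
transitivity (q * (- (x / q) - n%:R) *
  (n`!%:R * (q ^+ n * fps_pow1p 1 (- (x / q)) n))).
  by rewrite exprS; ring.
by rewrite IHn exprS; field.
Qed.

End FpsNumField.

(** * The two expansions of the poly-Cauchy polynomials *)

Section PolyCauchyTheory.
Context {R : realType} (k : nat) (a q : R) (L : 'I_k -> R).
Hypothesis q_neq0 : q != 0.

Local Notation P := (fps_pow (fps_ln1p (1 : R[i]))).
Local Notation lC := (lprod L)%:C.

Let qC_neq0 : q%:C != 0.
Proof. by rewrite fmorph_eq0. Qed.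

Lemma expr_lq n i : (i <= n)%N ->
  q%:C ^+ n * (- (lC / q%:C)) ^+ i = (-1) ^+ i * q%:C ^+ (n - i) * lC ^+ i.
Proof.
move=> le_in; rewrite -[in LHS](subnK le_in) exprD -mulrA -exprMn.
have -> : q%:C * - (lC / q%:C) = - lC by field.
by rewrite [(- lC) ^+ _]exprNn; ring.
Qed.

(** Identifies the numbers with the generating function at [x = 0], where the binomial factor is
    1. *)
Lemma poly_cauchy2E n m :
  poly_cauchy2 a q L n m =
  real_cpow (lprod L) a * (a%:C + m%:R) ^+ k / a%:C ^+ k *
  (n`!%:R * fps_comp (Lif k (a%:C + m%:R))
     (fps_scale (- (lC / q%:C)) (fps_ln1p q%:C)) n).
Proof.
rewrite fps_comp_ln1p /poly_cauchy2 !big_distrr /=; apply: eq_bigr => i _.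
rewrite /stirling1 /egf_coef /fps_scale /lpow /Lif.
have -> : a%:C + i%:R + m%:R = i%:R + (a%:C + m%:R) by ring.
have le_in : (i <= n)%N by rewrite -ltnS.
transitivity ((a%:C + m%:R) ^+ k / a%:C ^+ k * real_cpow (lprod L) a * n`!%:R *
  (i`!%:R)^-1 * P i n / (i%:R + (a%:C + m%:R)) ^+ k *
  ((-1) ^+ i * q%:C ^+ (n - i) * lC ^+ i)).
  by ring.
by rewrite -expr_lq //; ring.
Qed.

Lemma poly_cauchy2_poly_weighted n m (x : R[i]) :
  poly_cauchy2_poly a q L n m x =
    (a%:C + m%:R) ^+ k / a%:C ^+ k *
    \sum_(i < n.+1) q%:C ^+ (n - i) * weighted_stirling1 n i (x / q%:C) *
      ((-1) ^+ i * lpow L a i / (a%:C + i%:R + m%:R) ^+ k).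
Proof.
rewrite /poly_cauchy2_poly /egf_coef /poly_cauchy2_gf /fps_scale fps_mulC.
pose F := Lif k (a%:C + m%:R).
pose w := fps_pow1p (1 : R[i]) (- (x / q%:C)).
pose t := - (lC / q%:C).
rewrite -/F -/t.
have -> : fps_mul (fps_comp F (fps_scale t (fps_ln1p q%:C)))
     (fps_pow1p q%:C (- (x / q%:C))) n
  = \sum_(i < n.+1) q%:C ^+ n * (F i * t ^+ i) * fps_mul (P i) w n.
  rewrite /fps_mul; under [RHS]eq_bigr do rewrite big_distrr /=.
  rewrite exchange_big /=; apply: eq_bigr => j _.
  have le_jn : (j <= n)%N by rewrite -ltnS.
  rewrite fps_comp_ln1p fps_pow1p_dilate -/w.
  (* A range independent of [j] matches the exchanged double sum; the added terms vanish because
     [P i] has order at least [i]. *)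
  have -> : \sum_(i < j.+1) F i * t ^+ i * P i j =
            \sum_(i < n.+1) F i * t ^+ i * P i j.
    rewrite (big_ord_widen n.+1 (fun i => F i * t ^+ i * P i j)) ?ltnS //.
    rewrite big_mkcond /=; apply: eq_bigr => i _.
    by case: ltnP => // lt_ji; rewrite fps_pow_order // mulr0.
  have -> : q%:C ^+ n = q%:C ^+ j * q%:C ^+ (n - j) by rewrite -exprD subnKC.
  rewrite big_distrr big_distrl /=; apply: eq_bigr => i _.
  by ring.
rewrite !big_distrr /=; apply: eq_bigr => i _.
rewrite /weighted_stirling1 /egf_coef /fps_scale -/w /lpow /F /Lif.
have -> : a%:C + i%:R + m%:R = i%:R + (a%:C + m%:R) by ring.
have le_in : (i <= n)%N by rewrite -ltnS.
transitivity ((a%:C + m%:R) ^+ k / a%:C ^+ k * real_cpow (lprod L) a * n`!%:R *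
  (i`!%:R)^-1 * fps_mul (P i) w n / (i%:R + (a%:C + m%:R)) ^+ k *
  (q%:C ^+ n * t ^+ i)).
  by ring.
by rewrite expr_lq //; ring.
Qed.

Lemma poly_cauchy2_poly_qrising n m (x : R[i]) :
  poly_cauchy2_poly a q L n m x =
    \sum_(j < n.+1) (-1) ^+ (n - j) * 'C(n, j)%:R *
      poly_cauchy2 a q L j m * qrising q%:C x (n - j).
Proof.
rewrite /poly_cauchy2_poly /egf_coef /poly_cauchy2_gf /fps_scale fps_mulC.
rewrite /fps_mul !big_distrr /=; apply: eq_bigr => j _.
have le_jn : (j <= n)%N by rewrite -ltnS.
(* Splitting [n!] as ['C(n, j) j! (n - j)!] gives each factor of the Cauchy product its own
   factorial. *)
rewrite poly_cauchy2E /fps_scale -(bin_fact le_jn) !natrM.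
set S := _ / a%:C ^+ k; set G := fps_comp _ _ _.
transitivity ('C(n, j)%:R * (S * (j`!%:R * G)) *
  ((-1) ^+ (n - j) * qrising q%:C x (n - j))); last by ring.
by rewrite -fps_pow1p_qrising //; ring.
Qed.

End PolyCauchyTheory.

Theorem theorem15 (R : realType) (k : nat) (a q : R) (L : 'I_k -> R)
    (hk : (1 <= k)%N)
    (ha : forall j : nat, a + j%:R != 0)
    (hq : q != 0)
    (hL : forall i : 'I_k, L i != 0)
    (n m : nat) (x : R[i]) :
  poly_cauchy2_poly a q L n m x =
    (a%:C + m%:R) ^+ k / a%:C ^+ k *
    \sum_(i < n.+1) q%:C ^+ (n - i) * weighted_stirling1 n i (x / q%:C) *
      ((-1) ^+ i * lpow L a i / (a%:C + i%:R + m%:R) ^+ k)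
  /\
  poly_cauchy2_poly a q L n m x =
    \sum_(j < n.+1) (-1) ^+ (n - j) * 'C(n, j)%:R *
      poly_cauchy2 a q L j m * qrising q%:C x (n - j).
Proof.
by split; [exact: poly_cauchy2_poly_weighted | exact: poly_cauchy2_poly_qrising].
Qed.
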